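(* Let $\Delta t>0$, let $\phi^n$ (a function), $r^n$ (a real number) and $\bar\phi^{n+1/2}$ (a function) be given, where $\bar\phi^{n+1/2}$ is any explicit approximation of $\phi(t^{n+1/2})$ with an error of $O(\Delta t^2)$ (i.e. computed from previous time levels only). Consider the SAV/CN scheme for the unknowns $(\phi^{n+1},\mu^{n+1/2},r^{n+1})$: $$\frac{\phi^{n+1}-\phi^n}{\Delta t}=\mathcal G\mu^{n+1/2},$$ $$\mu^{n+1/2}=\tfrac12\mathcal L(\phi^{n+1}+\phi^n)+\frac{r^{n+1}+r^n}{2\sqrt{\mathcal E_1[\bar\phi^{n+1/2}]}}\,U[\bar\phi^{n+1/2}],$$ $$r^{n+1}-r^n=\int_\Omega\frac{U[\bar\phi^{n+1/2}]}{2\sqrt{\mathcal E_1[\bar\phi^{n+1/2}]}}(\phi^{n+1}-\phi^n)\,d\boldsymbol x .$$ Then: (1) The scheme is second-order accurate, in the sense of consistency: if $(\phi,\mu,r)$ is a sufficiently smooth exact solution of the reformulated gradient flow (given in the context), and one substitutes $\phi(t^n),\phi(t^{n+1}),\mu(t^{n+1/2}),r(t^n),r(t^{n+1})$ into the scheme (the third equation being divided by $\Delta t$), with $\bar\phi^{n+1/2}=\phi(t^{n+1/2})+O(\Delta t^2)$, then the residuals of all three equations are $O(\Delta t^2)$ as $\Delta t\to0$. (2) The scheme is unconditionally energy stable: for every $\Delta t>0$, every solution of the scheme satisfies $$\frac1{\Delta t}\Big[\tilde{\mathcal E}(\phi^{n+1},r^{n+1})-\tilde{\mathcal E}(\phi^n,r^n)\Big]=(\mu^{n+1/2},\mathcal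 G\mu^{n+1/2})\ (\le 0),\qquad \tilde{\mathcal E}(\phi,r)=\tfrac12(\phi,\mathcal L\phi)+r^2 .$$ (3) One can obtain $(\phi^{n+1},\mu^{n+1/2},r^{n+1})$ by solving two linear equations with constant coefficients of the form $(I-\tfrac{\Delta t}{2}\mathcal G\mathcal L)\bar x=\bar b$. That is, there are right-hand sides $\bar b_1,\bar b_2$ determined explicitly by $\phi^n,r^n,\bar\phi^{n+1/2}$ such that, with $x_1,x_2$ the corresponding solutions, $\phi^{n+1}=x_1+s\,x_2$, where $s\in\mathbb R$ is given explicitly through inner products of $x_1,x_2$ with known functions, and then $r^{n+1}$ and $\mu^{n+1/2}$ are given by the third and second equations of the scheme.
   Context: Setting: $\Omega$ is a domain, $(\phi,\psi)=\int_\Omega\phi\psi\,d\boldsymbol x$. Boundary conditions (e.g. periodic or homogeneous Neumann) are such that all boundary terms vanish when integrating by parts. $\mathcal G$ is a linear, symmetric, non-positive operator independent of $\phi$ ($(\mu,\mathcal G\mu)\le0$); $\mathcal L$ is a linear, symmetric, non-negative operator independent of $\phi$. The free energy is $\mathcal E[\phi]=\frac12(\phi,\mathcal L\phi)+\mathcal E_1[\phi]$, where the (sufficiently smooth) nonlinear functional $\mathcal E_1$ satisfies $\mathcal E_1[\phi]\ge C_0>0$ for all $\phi$, and $U[\phi]=\delta\mathcal E_1/\delta\phi$ is its variational derivative. All functions are assumed regular enough that the expressions written make sense, and linear equations of the form $(I-c\,\Delta t\,\mathcal G\mathcal L)\bar x=\bar b$, $c>0$, are assumed to be uniquely solvable.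 The gradient flow is $\partial_t\phi=\mathcal G\,\delta\mathcal E/\delta\phi$. With the scalar auxiliary variable $r(t)=\sqrt{\mathcal E_1[\phi(t)]}$, it is reformulated as $$\phi_t=\mathcal G\mu,\qquad \mu=\mathcal L\phi+\frac{r}{\sqrt{\mathcal E_1[\phi]}}U[\phi],\qquad r_t=\frac1{2\sqrt{\mathcal E_1[\phi]}}\int_\Omega U[\phi]\phi_t\,d\boldsymbol x .$$ Time levels: $t^n=n\Delta t$, $t^{n+1/2}=(n+\frac12)\Delta t$; $\phi^n$ and $r^n$ approximate $\phi(t^n)$ and $r(t^n)$. *)

(* Defs.v *)
From HB Require Import structures.
From mathcomp Require Import all_boot all_order all_algebra.
From mathcomp Require Import all_classical all_reals all_analysis.

Set Implicit Arguments.
Unset Strict Implicit.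
Unset Printing Implicit Defensive.

Import Order.TTheory GRing.Theory Num.Theory.
Import numFieldNormedType.Exports.

Local Open Scope classical_set_scope.
Local Open Scope ring_scope.

(* The d-dimensional Lebesgue measure is built on d-tuples of reals, which
   carry the product sigma-algebra: lebesgue_tuple n.+1 is the image of
   lebesgue_measure \x lebesgue_tuple n under (x, t) |-> x :: t.
   See lebesgue_tuple_box for its value on boxes. *)
Section LebesgueTuple.
Variable R : realType.
Local Open Scope ereal_scope.

Definition tcons (n : nat) (p : measurableTypeR R * n.-tuple (measurableTypeR R)) :
    n.+1.-tuple (measurableTypeR R) :=
  [tuple of p.1 :: p.2].

Lemma measurable_tcons n : measurable_fun setT (@tcons n).
Proof.
apply: (@measurable_cons _ _ _ (measurableTypeR R) fst n snd).
  exact: measurable_fst.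
exact: measurable_snd.
Qed.

Section step.
Variables (n : nat).
Variable m : {sigma_finite_measure set (n.-tuple (measurableTypeR R)) -> \bar R}.

Definition lebesgue_tcons : set (n.+1.-tuple (measurableTypeR R)) -> \bar R :=
  pushforward (@lebesgue_measure R \x m) (@tcons n).

Let lebesgue_tcons0 : lebesgue_tcons set0 = 0.
Proof. by rewrite /lebesgue_tcons /pushforward preimage_set0 measure0. Qed.

Let lebesgue_tcons_ge0 A : 0 <= lebesgue_tcons A.
Proof. by rewrite /lebesgue_tcons /pushforward; exact: measure_ge0. Qed.

Let lebesgue_tcons_semi_sigma_additive : semi_sigma_additive lebesgue_tcons.
Proof.
exact: (measure_semi_sigma_additive
  (s := measure_function_pushforward__canonical__measure_function_Measure
    (@lebesgue_measure R \x m) (measurable_tcons (n := n)))).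
Qed.

HB.instance Definition _ := isMeasure.Build _ _ _ lebesgue_tcons
  lebesgue_tcons0 lebesgue_tcons_ge0 lebesgue_tcons_semi_sigma_additive.

Lemma lebesgue_tcons_sigma_finite : sigma_finite setT lebesgue_tcons.
Proof.
have [F FT Ffin] : sigma_finite setT (@lebesgue_measure R \x m).
  have /sigma_finiteP[F [TF ndF Foo]] := sigma_finiteT (@lebesgue_measure R).
  have /sigma_finiteP[G [TG ndG Goo]] := sigma_finiteT m.
  exists (fun n => F n `*` G n).
    rewrite -setXTT TF TG predeqE => -[x y]; split.
      move=> [/= [i _ Fnx] [k _ Gky]]; exists (maxn i k) => //; split.
      - by move: x Fnx; exact/subsetPset/ndF/leq_maxl.
      - by move: y Gky; exact/subsetPset/ndG/leq_maxr.
    by move=> [i _ []/= ? ?]; split; exists i.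
  move=> k; have [? ?] := Foo k; have [? ?] := Goo k.
  split; first exact: measurableX.
  by rewrite product_measure1E// lte_mul_pinfty// ge0_fin_numE.
pose uc (t : n.+1.-tuple (measurableTypeR R)) :
    measurableTypeR R * n.-tuple (measurableTypeR R) :=
  (thead t, [tuple of behead t]).
have muc : measurable_fun setT uc.
  apply: measurable_fun_pair.
    exact: (@measurable_tnth _ _ n.+1 ord0).
  exact: measurable_behead.
exists (fun i => uc @^-1` F i).
  by rewrite -preimage_bigcup -FT preimage_setT.
move=> i; have [mF Fi] := Ffin i; split.
  by rewrite -[X in measurable X]setTI; exact: muc.
rewrite /lebesgue_tcons /pushforward -comp_preimage.
suff -> : uc \o @tcons n = id by rewrite preimage_id.
apply/funext => -[x t]; rewrite /uc /tcons /=; congr pair.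
by apply/val_inj.
Qed.

HB.instance Definition _ :=
  Measure_isSigmaFinite.Build _ _ _ lebesgue_tcons lebesgue_tcons_sigma_finite.

End step.

Fixpoint lebesgue_tuple (n : nat) :
    {sigma_finite_measure set (n.-tuple (measurableTypeR R)) -> \bar R} :=
  match n with
  | 0 => (\d_([tuple] : 0.-tuple (measurableTypeR R)) :
           {sigma_finite_measure set (0.-tuple (measurableTypeR R)) -> \bar R})
  | n'.+1 => lebesgue_tcons (lebesgue_tuple n')
  end.

Lemma measurable_tuple_box n (A : 'I_n -> set (measurableTypeR R)) :
  (forall i, measurable (A i)) ->
  measurable [set t : n.-tuple (measurableTypeR R) |
    forall i, A i (tnth t i)].
Proof.
move=> mA; rewrite [X in measurable X](_ : _ =
    \bigcap_(i in [set: 'I_n]) (@tnth n _ ^~ i) @^-1` A i).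
  apply: fin_bigcap_measurable; first exact: finite_finset.
  move=> i _; rewrite -[X in measurable X]setTI.
  exact: measurable_tnth.
by apply/seteqP; split => t /= h i => [_|]; exact: h.
Qed.

Lemma lebesgue_tuple_box n (A : 'I_n -> set (measurableTypeR R)) :
  (forall i, measurable (A i)) ->
  lebesgue_tuple n [set t | forall i, A i (tnth t i)] =
  \prod_(i < n) lebesgue_measure (A i).
Proof.
elim: n A => [|n IH] A mA /=.
  by rewrite big_ord0 diracE mem_set// => -[].
rewrite big_ord_recl -IH; last by move=> i; exact: mA.
rewrite /lebesgue_tcons /pushforward -product_measure1E//; last first.
  exact: (@measurable_tuple_box n (fun i => A (lift ord0 i))).
congr (_ _); apply/seteqP; split => -[x t] /=.
  move=> h; split=> /=; first by have := h ord0.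
  by move=> i; have := h (lift ord0 i); rewrite /tcons tnthS.
move=> [/= h0 h1] i; case: (unliftP ord0 i) => [j|] -> //.
by rewrite /tcons tnthS; exact: h1.
Qed.

End LebesgueTuple.

Section FunctionSpace.
Context (R : realType) (d : nat).

Definition row_of_tuple (t : d.-tuple (measurableTypeR R)) : 'rV[R]_d :=
  \row_i tnth t i.

Definition domain (Omega : set 'rV[R]_d) : Prop :=
  [/\ open Omega, connected Omega & Omega !=set0].

(* V is a space of regular functions on Omega, given by abstract elements
   together with the function ev u : R^d -> R they represent; only the values
   on Omega matter. Boundary conditions are part of the choice of V. *)
Context (Omega : set 'rV[R]_d) (V : normedModType R)
        (ev : V -> 'rV[R]_d -> R).

Definition inner (u v : V) : R :=
  \int[lebesgue_tuple R d]_(t in row_of_tuple @^-1` Omega)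
    (ev u (row_of_tuple t) * ev v (row_of_tuple t)).

(* The norm of V is any norm at least as strong as the L^2(Omega) norm. *)
Definition function_space : Prop :=
  [/\ forall (a : R) u v x, ev (a *: u + v) x = a * ev u x + ev v x,
      forall u v, (forall x, Omega x -> ev u x = ev v x) -> u = v,
      forall u v, (lebesgue_tuple R d).-integrable (row_of_tuple @^-1` Omega)
        (fun t => (ev u (row_of_tuple t) * ev v (row_of_tuple t))%:E) &
      exists C : R, forall u, Num.sqrt (inner u u) <= C * `|u|].

Definition stronger_norm (N : V -> R) : Prop :=
  [/\ forall u v, N (u + v) <= N u + N v,
      forall (a : R) u, N (a *: u) = `|a| * N u &
      exists C : R, forall u, `|u| <= C * N u].

Definition symmetric_op (A : V -> V) : Prop :=
  forall u v, inner (A u) v = inner u (A v).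

Definition nonpositive_op (A : V -> V) : Prop := forall u, inner u (A u) <= 0.

Definition nonnegative_op (A : V -> V) : Prop := forall u, 0 <= inner u (A u).

Definition variational_derivative (E1 : V -> R) (U : V -> V) : Prop :=
  forall phi eta, is_derive phi eta E1 (inner (U phi) eta).

Definition locally_lipschitz (N : V -> R) (U : V -> V) : Prop :=
  forall phi, exists2 e : R, 0 < e & exists K : R, forall u v,
    N (u - phi) < e -> N (v - phi) < e -> `|U u - U v| <= K * N (u - v).

Definition uniquely_solvable (G L : V -> V) : Prop :=
  forall c dt : R, 0 < c -> 0 < dt -> forall b,
    exists! x, x - (c * dt) *: G (L x) = b.

End FunctionSpace.

(* f is of class C^k on [0, T], with derivatives at the end points understood
   as continuous extensions; g j is the j-th derivative of f. *)
Definition Ck_curve (R : realType) (V : normedModType R) (T : R) (k : nat)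
    (f : R -> V) : Prop :=
  exists g : nat -> R -> V,
    [/\ g 0%N = f,
        forall j, (j <= k)%N -> {within `[0, T], continuous (g j)} &
        forall j, (j < k)%N -> forall t, t \in `]0, T[ ->
          is_derive t 1 (g j) (g j.+1 t)].

(* e dt n = O(dt^2) as dt -> 0+, uniformly over the steps [n dt, (n+1) dt]
   contained in [0, T]. *)
Definition O_dt2 (R : realType) (T : R) (e : R -> nat -> R) : Prop :=
  exists C : R, \forall dt \near 0^'+, forall n : nat,
    n.+1%:R * dt <= T -> `|e dt n| <= C * dt ^+ 2.

Section SAV.
Context (R : realType) (V : normedModType R) (ip : V -> V -> R)
        (G L : V -> V) (E1 : V -> R) (U : V -> V).

Definition sav_flow (T : R) (phi mu : R -> V) (r : R -> R) : Prop :=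
  forall t, t \in `]0, T[ ->
  [/\ is_derive t 1 phi (G (mu t)),
      mu t = L (phi t) + (r t / Num.sqrt (E1 (phi t))) *: U (phi t) &
      is_derive t 1 r
        ((2 * Num.sqrt (E1 (phi t)))^-1 * ip (U (phi t)) ('D_1 phi t))].

Definition smooth_solution (N : V -> R) (T : R) (phi : R -> V) (r : R -> R) :
    Prop :=
  [/\ Ck_curve T 3 phi,
      Ck_curve T 2 (fun t => L (phi t)),
      Ck_curve T 3 r &
      forall t, t \in `[0, T] ->
        N (phi s - phi t) @[s --> within `[0, T] (nbhs t)] --> (0 : R)].

(* phi0, r0 at t^n; phib is the explicit approximation at t^{n+1/2};
   phi1, r1 at t^{n+1} and mu at t^{n+1/2}. *)
Definition sav_mu (phi0 : V) (r0 : R) (phib phi1 : V) (r1 : R) : V :=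
  2^-1 *: L (phi1 + phi0)
  + ((r1 + r0) / (2 * Num.sqrt (E1 phib))) *: U phib.

Definition sav_dr (phi0 phib phi1 : V) : R :=
  ip ((2 * Num.sqrt (E1 phib))^-1 *: U phib) (phi1 - phi0).

Definition sav_cn (dt : R) (phi0 : V) (r0 : R) (phib : V)
    (phi1 mu : V) (r1 : R) : Prop :=
  [/\ dt^-1 *: (phi1 - phi0) = G mu,
      mu = sav_mu phi0 r0 phib phi1 r1 &
      r1 - r0 = sav_dr phi0 phib phi1].

Definition residual_phi (dt : R) (phi0 phi1 mu : V) : V :=
  dt^-1 *: (phi1 - phi0) - G mu.

Definition residual_mu (phi0 : V) (r0 : R) (phib phi1 mu : V) (r1 : R) : V :=
  mu - sav_mu phi0 r0 phib phi1 r1.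

Definition residual_r (dt : R) (phi0 : V) (r0 : R) (phib phi1 : V) (r1 : R) :
    R :=
  (r1 - r0 - sav_dr phi0 phib phi1) / dt.

Definition sav_energy (phi : V) (r : R) : R := 2^-1 * ip phi (L phi) + r ^+ 2.

(* Eliminating mu and r1 from the scheme gives, with b = sav_b phib,
     (I - dt/2 G L) phi1
       = phi0 + dt/2 G L phi0 + dt (r0 - (b, phi0) / 4) G b
         + dt/4 (b, phi1) G b,
   so that phi1 = x1 + s x2 with s = dt/4 (b, phi1), where x1 and x2 solve the
   two linear equations with right-hand sides sav_rhs1 and sav_rhs2; taking the
   inner product with b gives s = dt/4 ((b, x1) + s (b, x2)). *)
Definition sav_b (phib : V) : V := (Num.sqrt (E1 phib))^-1 *: U phib.

Definition sav_rhs1 (dt : R) (phi0 : V) (r0 : R) (phib : V) : V :=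
  phi0 + (dt / 2) *: G (L phi0)
  + (dt * (r0 - 4^-1 * ip (sav_b phib) phi0)) *: G (sav_b phib).

Definition sav_rhs2 (phib : V) : V := G (sav_b phib).

Definition sav_denom (dt : R) (phib x2 : V) : R :=
  1 - dt / 4 * ip (sav_b phib) x2.

Definition sav_coef (dt : R) (phib x1 x2 : V) : R :=
  dt / 4 * ip (sav_b phib) x1 / sav_denom dt phib x2.

End SAV.

(* Main.v *)
(* Consistency.  Taylor expansion about the midpoint t^{n+1/2} reduces the
   residuals to the local Lipschitz continuity of b = U / sqrt E1 in the norm N
   along the trajectory: E1 is locally Lipschitz by the mean value theorem on
   segments, U being locally bounded, and the constants are uniform because the
   trajectory is N-compact.  V need not be complete, so Taylor's formula comes
   from a mean value inequality rather than from integral remainders.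

   Stability.  Pair the first equation with mu^{n+1/2}: by symmetry of L the
   linear part telescopes, and (r^{n+1} + r^n) (r^{n+1} - r^n) is the increment
   of r^2.

   Solvability.  Eliminating mu^{n+1/2} and r^{n+1} leaves a rank-one
   perturbation of I - dt/2 G L; its scalar denominator is at least 1 because
   (b, (I - dt/2 G L)^-1 G b) <= 0. *)
Require Import Defs.
From HB Require Import structures.
From mathcomp Require Import all_boot all_order all_algebra.
From mathcomp Require Import all_classical all_reals all_analysis.
From mathcomp Require Import ring lra.

Set Implicit Arguments.
Unset Strict Implicit.
Unset Printing Implicit Defensive.

Import Order.TTheory GRing.Theory Num.Theory.
Import numFieldNormedType.Exports.

Local Open Scope classical_set_scope.
Local Open Scope ring_scope.

(** * The L2 inner product *)

(** Tuples carry the product sigma-algebra, row vectors the sup-norm topology. The bridge is that an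
    open set is a countable union of boxes with rational centre and radius. *)
Lemma measurable_preimage_row_of_tuple (R : realType) (d : nat)
    (O : set 'rV[R]_d) :
  open O -> measurable (@row_of_tuple R d @^-1` O).
Proof.
move=> oO.
pose I := [set p : d.-tuple rat * rat |
  forall t : d.-tuple (measurableTypeR R),
    (forall i, `|tnth t i - ratr (tnth p.1 i)| < ratr p.2) ->
    O (row_of_tuple t)].
pose B (p : d.-tuple rat * rat) := [set t : d.-tuple (measurableTypeR R) |
  forall i, ball (ratr (tnth p.1 i) : R) (ratr p.2) (tnth t i)].
have -> : @row_of_tuple R d @^-1` O = \bigcup_(p in I) B p.
  apply/seteqP; split => [t Ot|t [p Ip Bpt]]; last first.
    by apply: Ip => i; have := Bpt i; rewrite /ball/= distrC.
  have := oO; rewrite openE => /(_ _ Ot) /nbhs_ballP[e /= e0 He].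
  have [q /[!in_itv]/= /andP[q0 qe]] := rat_in_itvoo (divr_gt0 e0 (ltr0Sn R 1)).
  have ex i : exists a : rat, `|tnth t i - ratr a| < ratr q.
    have lt : tnth t i - ratr q < tnth t i + ratr q by lra.
    have [a /[!in_itv]/= /andP[a1 a2]] := rat_in_itvoo lt.
    by exists a; rewrite ltr_norml; apply/andP; split; lra.
  have [f fP] := choice ex.
  exists ([tuple f i | i < d], q) => /=.
    move=> s Hs; apply: He; split=> // i j; rewrite /ball/= !mxE.
    have := Hs j; rewrite /= tnth_mktuple => Hsj.
    have := fP j; set a := ratr (f j) => Ha.
    have -> : tnth t j - tnth s j = (tnth t j - a) - (tnth s j - a) by ring.
    apply: le_lt_trans (ler_normB _ _) _; lra.
  by move=> i; rewrite /ball/= tnth_mktuple distrC; exact: fP.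
rewrite bigcup_mkcond; apply: countable_bigcupT_measurable => [|p].
  exact: countableP.
case: ifP => // _; apply: (@measurable_tuple_box R d
  (fun i => ball (ratr (tnth p.1 i) : R) (ratr p.2))) => i.
by rewrite ball_itv; exact: measurable_itv.
Qed.

Section InnerProduct.
Context (R : realType) (d : nat) (Omega : set 'rV[R]_d).
Context (V : normedModType R) (ev : V -> 'rV[R]_d -> R).
Hypothesis Omega_open : open Omega.
Hypothesis V_functions : function_space Omega ev.

Local Notation ip := (inner Omega ev).

Lemma innerC u v : ip u v = ip v u.
Proof. by apply: eq_Rintegral => t _; rewrite mulrC. Qed.

Lemma inner_linearl a u v w : ip (a *: u + v) w = a * ip u w + ip v w.
Proof.
have [evl _ evi _] := V_functions.
have mD := measurable_preimage_row_of_tuple Omega_open.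
(* The coefficient -1 turns linearity at zero into [ev 0 x = - ev 0 x + ev 0 x]. *)
have ev0 x : ev 0 x = 0 by have := evl (-1) 0 0 x; rewrite scaler0 addr0; lra.
have Iau : (lebesgue_tuple R d).-integrable (@row_of_tuple R d @^-1` Omega)
    (EFin \o (fun t => a * (ev u (row_of_tuple t) * ev w (row_of_tuple t)))).
  have := evi (a *: u) w; congr (_.-integrable _ _).
  apply/funext => t /=; congr EFin.
  by have := evl a u 0 (row_of_tuple t); rewrite !addr0 ev0 addr0 => ->; ring.
rewrite /inner -RintegralZl; [|exact: mD|exact: evi].
rewrite -RintegralD; [|exact: mD|exact: Iau|exact: evi].
by apply: eq_Rintegral => t _; rewrite evl mulrDl mulrA.
Qed.

Lemma innerDl u v w : ip (u + v) w = ip u w + ip v w.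
Proof. by rewrite -[u in LHS]scale1r inner_linearl mul1r. Qed.

Lemma inner0l w : ip 0 w = 0.
Proof. by have := innerDl 0 0 w; rewrite addr0; lra. Qed.

Lemma innerZl a u w : ip (a *: u) w = a * ip u w.
Proof. by rewrite -[a *: u]addr0 inner_linearl inner0l addr0. Qed.

Lemma innerDr w u v : ip w (u + v) = ip w u + ip w v.
Proof. by rewrite innerC innerDl !(innerC _ w). Qed.

Lemma innerZr a w u : ip w (a *: u) = a * ip w u.
Proof. by rewrite innerC innerZl (innerC _ w). Qed.

Lemma innerBl u v w : ip (u - v) w = ip u w - ip v w.
Proof. by rewrite innerDl -scaleN1r innerZl mulN1r. Qed.

Lemma innerBr w u v : ip w (u - v) = ip w u - ip w v.
Proof. by rewrite innerC innerBl !(innerC _ w). Qed.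

Lemma inner_ge0 u : 0 <= ip u u.
Proof. by apply: Rintegral_ge0 => t _; rewrite -expr2 sqr_ge0. Qed.

(** The quadratic polynomial [t |-> ip (t *: u + v) (t *: u + v)] is nonnegative, so its
    discriminant is not positive. *)
Lemma inner_cauchy_schwarz u v : ip u v ^+ 2 <= ip u u * ip v v.
Proof.
have q (t : R) : 0 <= ip u u * t ^+ 2 + 2 * ip u v * t + ip v v.
  suff -> : ip u u * t ^+ 2 + 2 * ip u v * t + ip v v =
      ip (t *: u + v) (t *: u + v) by exact: inner_ge0.
  by rewrite innerDl !innerDr !innerZl !innerZr (innerC v u); ring.
have := inner_ge0 u; rewrite le_eqVlt => /orP[/eqP u0|u0].
  (* When [ip u u] vanishes the polynomial is affine; at this point it would equal -1 unless
     [ip u v = 0]. *)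
  have /= := q (- (ip v v + 1) / (2 * ip u v)); rewrite -u0 !mul0r add0r.
  have [->|uv0] := eqVneq (ip u v) 0; first by rewrite expr0n.
  by rewrite mulrC divfK ?mulf_neq0 ?pnatr_eq0//; lra.
rewrite -subr_ge0.
(* The polynomial is evaluated at its minimiser [- ip u v / ip u u]. *)
have -> : ip u u * ip v v - ip u v ^+ 2 = ip u u *
    (ip u u * (- ip u v / ip u u) ^+ 2 +
     2 * ip u v * (- ip u v / ip u u) + ip v v).
  by field; rewrite gt_eqF.
by rewrite pmulr_rge0.
Qed.

Lemma inner_bounded :
  exists2 K : R, 0 < K & forall u v, `|ip u v| <= K * (`|u| * `|v|).
Proof.
have [_ _ _ [C CP]] := V_functions.
(* The summand 1 makes the constant strictly positive even when [C] is zero. *)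
exists (C ^+ 2 + 1); first by rewrite ltr_wpDl ?sqr_ge0.
move=> u v; apply: (@le_trans _ _ (C ^+ 2 * (`|u| * `|v|))); last first.
  by rewrite ler_wpM2r ?mulr_ge0// lerDl.
have -> : C ^+ 2 * (`|u| * `|v|) = (C * `|u|) * (C * `|v|) by ring.
apply: le_trans (ler_pM (sqrtr_ge0 _) (sqrtr_ge0 _) (CP u) (CP v)).
rewrite -sqrtrM ?inner_ge0// -sqrtr_sqr ler_sqrt ?mulr_ge0 ?inner_ge0//.
exact: inner_cauchy_schwarz.
Qed.

End InnerProduct.

(** * Mean value inequality and Taylor expansion of curves *)

Section MeanValue.
Context (R : realType) (V : normedModType R).

Lemma is_derive_scalel (c : R -> R) (dc : R) (v : V) (t : R) :
  is_derive t 1 c dc -> is_derive t 1 (fun s => c s *: v) (dc *: v).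
Proof.
move=> [cd cv]; apply: DeriveDef.
  by apply/derivable1_diffP; apply: differentiableZl; apply/derivable1_diffP.
rewrite deriveE; last by apply: differentiableZl; apply/derivable1_diffP.
rewrite diffZl; last by apply/derivable1_diffP.
by rewrite -deriveE ?cv//; apply/derivable1_diffP.
Qed.

(* If the inequality failed for some k > M, the function
   t |-> |f t - f a| - k t would not attain its minimum at b; but it strictly
   decreases to the right of every interior point. *)
Lemma mean_value_open (f df : R -> V) (a b M : R) : a < b ->
  (forall t, t \in `[a, b[ -> is_derive t 1 f (df t)) ->
  (forall t, t \in `[a, b[ -> `|df t| <= M) ->
  {within `[a, b], continuous f} ->
  `|f b - f a| <= M * (b - a).
Proof.
move=> ab fd dfM fc.
have ba0 : 0 < b - a by rewrite subr_gt0.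
suff H k : M < k -> `|f b - f a| <= k * (b - a).
  rewrite -ler_pdivrMr//; apply/ler_addgt0Pr => e e0.
  by rewrite ler_pdivrMr//; apply: H; rewrite ltrDl.
move=> Mk; pose h t := `|f t - f a| - k * t.
have idc : {within `[a, b], continuous (id : R -> R)}.
  by apply: continuous_subspaceT => x; exact: cvg_id.
have hc : {within `[a, b], continuous h}.
  move=> t; apply: cvgB; first by apply: cvg_norm; apply: cvgB (fc t) (cvg_cst _).
  apply: cvgM; first exact: cvg_cst.
  exact: idc.
have [c cab cmin] := EVT_min (ltW ab) hc.
have {}cab : a <= c <= b by move: cab; rewrite in_itv.
have [cb|bc] := ltP c b; last first.
  have -> : b = c by move: cab bc => /andP[_]; lra.
  have := cmin a; rewrite in_itv/= lexx ltW// => /(_ erefl).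
  rewrite /h subrr normr0; lra.
have ccb : c \in `[a, b[ by rewrite in_itv/=; case/andP: cab => ->.
have [fdc fdv] := fd c ccb.
exfalso.
have kc : `|df c| < k by apply: le_lt_trans Mk; exact: dfM.
have := fdc; rewrite /derivable => /cvg_ex[l /= lP].
have ldf : l = df c by rewrite -fdv; apply/esym/cvg_lim.
have /= := cvgr_norm_lt _ lP; rewrite ldf => /(_ _ _ kc).
rewrite /dnbhs near_withinE => near0.
near (0:R)^'+ => e.
have e0 : 0 < e by near: e; exact: nbhs_right_gt.
have ebc : e < b - c by near: e; apply: nbhs_right_lt; rewrite subr_gt0.
have : `|e^-1 *: (f (e *: 1 + c) - f c)| < k.
  by have : e != 0 by [rewrite gt_eqF]; near: e; exact: cvg_within near0.
rewrite normrZ gtr0_norm ?invr_gt0// [e *: 1]mulr1 mulrC ltr_pdivrMr// => lt.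
have := cmin (e + c); rewrite in_itv/= => /(_ _)/wrap[|].
  by case/andP: cab => ac _; apply/andP; split; lra.
rewrite /h; have := ler_distD (f c) (f (e + c)) (f a); lra.
Unshelve. all: by end_near. Qed.
(** The derivative is now required only in the open interval: the previous bound holds on [[x, b]]
    for every interior [x], and continuity lets [x] tend to [a] from the right. *)
Lemma mean_value_ineq (f df : R -> V) (a b M : R) : a < b ->
  (forall t, t \in `]a, b[ -> is_derive t 1 f (df t)) ->
  (forall t, t \in `]a, b[ -> `|df t| <= M) ->
  {within `[a, b], continuous f} ->
  `|f b - f a| <= M * (b - a).
Proof.
move=> ab fd dfM fc; have [_ fa _] := (continuous_within_itvP f ab).1 fc.
rewrite -subr_ge0.
have : M * (b - x) - `|f b - f x| @[x --> a^'+] --> M * (b - a) - `|f b - f a|.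
  apply: cvgB.
    apply: cvgM; first exact: cvg_cst.
    by apply: cvgB; [exact: cvg_cst|apply: cvg_at_right_filter; exact: cvg_id].
  by apply: cvg_norm; apply: cvgB; [exact: cvg_cst|exact: fa].
move=> /cvgr_to_ge; apply; near=> x.
have ax : a < x by near: x; exact: nbhs_right_gt.
have xb : x < b by near: x; exact: nbhs_right_lt.
rewrite subr_ge0; apply (@mean_value_open f df x b M xb).
- move=> t; rewrite in_itv/= => /andP[xt tb]; apply: fd.
  by rewrite in_itv/= tb (lt_le_trans ax xt).
- move=> t; rewrite in_itv/= => /andP[xt tb]; apply: dfM.
  by rewrite in_itv/= tb (lt_le_trans ax xt).
- apply: continuous_subspaceW fc => t /=; rewrite !in_itv/= => /andP[xt ->].
  by rewrite (le_trans (ltW ax) xt).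
Unshelve. all: by end_near. Qed.

Lemma mean_value_lipschitz (f df : R -> V) (a b M x y : R) :
  (forall t, t \in `]a, b[ -> is_derive t 1 f (df t)) ->
  (forall t, t \in `]a, b[ -> `|df t| <= M) ->
  {within `[a, b], continuous f} ->
  x \in `[a, b] -> y \in `[a, b] -> `|f x - f y| <= M * `|x - y|.
Proof.
move=> fd dfM fc; wlog xy : x y / y <= x => [H|].
  have [/H//|/ltW xy xab yab] := leP y x.
  by rewrite distrC (distrC x); exact: H.
rewrite !in_itv/= => /andP[ax xb] /andP[ay yb].
move: xy; rewrite le_eqVlt => /orP[/eqP->|xy]; first by rewrite !subrr !normr0 mulr0.
rewrite gtr0_norm ?subr_gt0//.
apply (@mean_value_ineq f df y x M xy).
- move=> t; rewrite in_itv/= => /andP[? ?]; apply: fd.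
  by rewrite in_itv/=; apply/andP; split; lra.
- move=> t; rewrite in_itv/= => /andP[? ?]; apply: dfM.
  by rewrite in_itv/=; apply/andP; split; lra.
- apply: continuous_subspaceW fc => t /=; rewrite !in_itv/= => /andP[? ?].
  by apply/andP; split; lra.
Qed.

(** The mean value inequality is used twice, first for [f1] minus its affine model with slope [v],
    then for [f] minus the quadratic model. The free vector [v] serves two purposes: [v = 0] gives a
    second-order remainder, [v = f2 m] a third-order one. *)
Lemma taylor2 (f f1 f2 : R -> V) (a b K m x : R) (v : V) :
  (forall t, t \in `]a, b[ -> is_derive t 1 f (f1 t)) ->
  (forall t, t \in `]a, b[ -> is_derive t 1 f1 (f2 t)) ->
  {within `[a, b], continuous f} -> {within `[a, b], continuous f1} ->
  (forall t, t \in `]a, b[ -> `|f2 t - v| <= K) ->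
  m \in `[a, b] -> x \in `[a, b] ->
  `|f x - f m - (x - m) *: f1 m - ((x - m) ^+ 2 / 2) *: v|
    <= K * (b - a) * `|x - m|.
Proof.
move=> fd f1d fc f1c f2K mab xab.
have [ab|ba] := ltP a b; last first.
  have -> : x = m by move: mab xab; rewrite !in_itv/=; lra.
  by rewrite !subrr expr0n mul0r !scale0r !subr0 !normr0 mulr0.
have dlin (t : R) : is_derive t 1 (fun s : R => s - m) 1.
  by have := is_deriveB (is_derive_id t 1) (is_derive_cst m t 1); rewrite subr0.
have dsq (t : R) : is_derive t 1 (fun s : R => (s - m) ^+ 2 / 2) (t - m).
  have := is_deriveM (is_deriveM (dlin t) (dlin t)) (is_derive_cst (2^-1 : R) t 1).
  by move=> /is_derive_eq; apply; rewrite /GRing.scale/= mulr0; field.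
pose F s := f1 s - (s - m) *: v.
have cZ (c : R -> R) (w : V) : continuous c ->
    {within `[a, b], continuous (fun s => c s *: w)}.
  move=> cc; apply: continuous_subspaceT => u.
  by apply: cvgZr_tmp; exact: cc.
have clin : continuous (fun s : R => s - m).
  by move=> t; apply: cvgB; [exact: cvg_id|exact: cvg_cst].
have Fc : {within `[a, b], continuous F}.
  by move=> t; apply: cvgB; [exact: f1c|exact: (cZ (fun s => s - m) v clin)].
have FK s : s \in `[a, b] -> `|F s - f1 m| <= K * (b - a).
  move=> sab; have -> : f1 m = F m by rewrite /F subrr scale0r subr0.
  apply: (@le_trans _ _ (K * `|s - m|)).
    apply (@mean_value_lipschitz F (fun t => f2 t - v) a b).
    - move=> t tab.
      have := is_deriveB (f1d t tab) (is_derive_scalel v (dlin t)).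
      by rewrite scale1r.
    - exact: f2K.
    - exact: Fc.
    - exact: sab.
    - exact: mab.
  apply: ler_wpM2l.
    (* [K] is nonnegative because it bounds a norm at the midpoint of the interval. *)
    have cab : (a + b) / 2 \in `]a, b[ by rewrite in_itv/=; lra.
    exact: le_trans (f2K _ cab).
  by move: mab sab; rewrite !in_itv/= ler_norml => /andP[? ?] /andP[? ?]; lra.
pose Q s := f s - (s - m) *: f1 m - ((s - m) ^+ 2 / 2) *: v.
have -> : f x - f m - (x - m) *: f1 m - ((x - m) ^+ 2 / 2) *: v = Q x - Q m.
  rewrite /Q subrr expr0n mul0r !scale0r !subr0.
  by rewrite -!addrA; congr (_ + _); rewrite addrC !addrA.
apply (@mean_value_lipschitz Q (fun t => F t - f1 m) a b);
  [| | |exact: xab|exact: mab].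
- move=> t tab.
  have := is_deriveB (is_deriveB (fd t tab) (is_derive_scalel (f1 m) (dlin t)))
    (is_derive_scalel v (dsq t)).
  by move=> /is_derive_eq; apply; rewrite scale1r /F addrAC.
- by move=> t tab; apply: FK; exact: subset_itv_oo_cc.
- move=> t; apply: cvgB; last first.
    apply: (cZ (fun s => (s - m) ^+ 2 / 2) v) => u.
    apply: cvgM; last exact: cvg_cst.
    by apply: cvgM; exact: clin.
  by apply: cvgB; [exact: fc|exact: (cZ (fun s => s - m) (f1 m) clin)].
Qed.

(** * Bounds and midpoint formulas for curves of class [C^k] *)

Lemma within_continuous_bounded (g : R -> V) (a b : R) :
  {within `[a, b], continuous g} ->
  exists2 K : R, 0 <= K & forall t, t \in `[a, b] -> `|g t| <= K.
Proof.
move=> gc; have [ab|ba] := leP a b; last first.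
  by exists 0 => // t; rewrite in_itv/=; lra.
have ngc : {within `[a, b], continuous (fun t => `|g t|)}.
  by move=> t; apply: cvg_norm; exact: gc.
by have [c _ cmax] := EVT_max ab ngc; exists `|g c|.
Qed.

Lemma Ck_curveW (T : R) (j k : nat) (f : R -> V) :
  (j <= k)%N -> Ck_curve T k f -> Ck_curve T j f.
Proof.
move=> jk [g [g0 gc gd]]; exists g; split => // i ij.
  exact/gc/(leq_trans ij).
exact/gd/(leq_trans ij).
Qed.

(** In the sum of the expansions at [m + h] and [m - h] the first-order terms cancel. *)
Lemma midpoint_average (T : R) (f : R -> V) : Ck_curve T 2 f ->
  exists2 K : R, 0 <= K & forall m h, 0 < h -> 0 <= m - h -> m + h <= T ->
    `|2^-1 *: (f (m + h) + f (m - h)) - f m| <= K * h ^+ 2.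
Proof.
move=> [g [<- gc gd]].
have [K K0 gK] := within_continuous_bounded (gc 2%N isT).
(* Each expansion has remainder at most [K * (2 * h) * h]; their average is at most
   [2 * K * h ^+ 2]. *)
exists (2 * K); first by rewrite mulr_ge0.
move=> m h h0 mh0 mhT.
have sub (x : R) : x \in `[m - h, m + h] -> x \in `[0, T].
  by rewrite !in_itv/=; lra.
have subo (x : R) : x \in `]m - h, m + h[ -> x \in `]0, T[.
  by rewrite !in_itv/=; lra.
have taylor x : x \in `[m - h, m + h] ->
    `|g 0%N x - g 0%N m - (x - m) *: g 1%N m - ((x - m) ^+ 2 / 2) *: 0|
      <= K * ((m + h) - (m - h)) * `|x - m|.
  move=> xmh; apply (@taylor2 (g 0%N) (g 1%N) (g 2%N)).
  - by move=> t /subo; exact: gd.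
  - by move=> t /subo; exact: gd.
  - exact: continuous_subspaceW sub (gc 0%N isT).
  - exact: continuous_subspaceW sub (gc 1%N isT).
  - by move=> t /subo tT; rewrite subr0; apply: gK; exact: subset_itv_oo_cc.
  - by rewrite in_itv/=; lra.
  - exact: xmh.
have /taylor : m + h \in `[m - h, m + h] by rewrite in_itv/=; lra.
have /taylor : m - h \in `[m - h, m + h] by rewrite in_itv/=; lra.
rewrite !scaler0 !subr0 opprB.
have -> : m - h - m = - h by ring.
have -> : m + h - m = h by ring.
have -> : m + h + (h - m) = 2 * h by ring.
rewrite scaleNr opprK normrN gtr0_norm// => B A.
have -> : 2^-1 *: (g 0%N (m + h) + g 0%N (m - h)) - g 0%N m =
    2^-1 *: ((g 0%N (m - h) - g 0%N m + h *: g 1%N m) +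
             (g 0%N (m + h) - g 0%N m - h *: g 1%N m)).
  rewrite addrACA subrr addr0 addrACA -opprD scalerBr; congr (_ - _).
    by rewrite addrC.
  by rewrite scalerDr -scalerDl (_ : 2^-1 + 2^-1 = 1) ?scale1r//; lra.
rewrite normrZ gtr0_norm ?invr_gt0//.
by have := ler_normD (g 0%N (m - h) - g 0%N m + h *: g 1%N m)
  (g 0%N (m + h) - g 0%N m - h *: g 1%N m); lra.
Qed.

(** In the difference of the two expansions the terms of even order cancel. The cruder second bound
    controls increments that multiply a quantity already of second order. *)
Lemma midpoint_difference (T : R) (f f' : R -> V) : Ck_curve T 3 f ->
  (forall t, t \in `]0, T[ -> is_derive t 1 f (f' t)) ->
  exists2 K : R, 0 <= K & forall m h, 0 < h -> 0 <= m - h -> m + h <= T ->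
    `|f (m + h) - f (m - h) - (2 * h) *: f' m| <= K * h ^+ 3 /\
    `|f (m + h) - f (m - h)| <= K * h.
Proof.
move=> [g [<- gc gd]] f'P.
have [K1 K10 gK1] := within_continuous_bounded (gc 1%N isT).
have [K3 K30 gK3] := within_continuous_bounded (gc 3%N isT).
(* [4 * K3] collects two Taylor remainders [K3 * h * (2 * h) * h]; [2 * K1] comes from the mean
   value inequality on an interval of length [2 * h]. *)
exists (4 * K3 + 2 * K1); first by rewrite addr_ge0 ?mulr_ge0.
move=> m h h0 mh0 mhT.
have sub (x : R) : x \in `[m - h, m + h] -> x \in `[0, T].
  by rewrite !in_itv/=; lra.
have subo (x : R) : x \in `]m - h, m + h[ -> x \in `]0, T[.
  by rewrite !in_itv/=; lra.
have mo : m \in `]m - h, m + h[ by rewrite in_itv/=; lra.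
(* Both are the derivative of [f] at the interior point [m]. *)
have -> : f' m = g 1%N m.
  have [_ <-] := f'P _ (subo _ mo).
  by have [_ <-] := gd 0%N isT _ (subo _ mo).
split; last first.
  apply: (@le_trans _ _ (K1 * `|(m + h) - (m - h)|)); last first.
    rewrite gtr0_norm; last lra.
    have : 0 <= K3 * h by rewrite mulr_ge0// ltW.
    lra.
  apply (@mean_value_lipschitz (g 0%N) (g 1%N) (m - h) (m + h)).
  - by move=> t /subo; exact: gd.
  - by move=> t /subo tT; apply: gK1; exact: subset_itv_oo_cc.
  - exact: continuous_subspaceW sub (gc 0%N isT).
  - by rewrite in_itv/=; lra.
  - by rewrite in_itv/=; lra.
have taylor x : x \in `[m - h, m + h] ->
    `|g 0%N x - g 0%N m - (x - m) *: g 1%N m - ((x - m) ^+ 2 / 2) *: g 2%N m|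
      <= K3 * h * ((m + h) - (m - h)) * `|x - m|.
  move=> xmh; apply (@taylor2 (g 0%N) (g 1%N) (g 2%N)).
  - by move=> t /subo; exact: gd.
  - by move=> t /subo; exact: gd.
  - exact: continuous_subspaceW sub (gc 0%N isT).
  - exact: continuous_subspaceW sub (gc 1%N isT).
  (* The bound on [g 3] makes [g 2] Lipschitz, so [g 2] stays within [K3 * h] of its midpoint
     value. *)
  - move=> t tmh; apply: (@le_trans _ _ (K3 * `|t - m|)).
      apply (@mean_value_lipschitz (g 2%N) (g 3%N) (m - h) (m + h)).
      + by move=> s /subo; exact: gd.
      + by move=> s /subo sT; apply: gK3; exact: subset_itv_oo_cc.
      + exact: continuous_subspaceW sub (gc 2%N isT).
      + exact: subset_itv_oo_cc.
      + exact: subset_itv_oo_cc.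
    apply: ler_wpM2l => //; move: tmh; rewrite in_itv/= ler_norml => /andP[? ?].
    by apply/andP; split; lra.
  - exact: subset_itv_oo_cc.
  - exact: xmh.
have /taylor : m + h \in `[m - h, m + h] by rewrite in_itv/=; lra.
have /taylor : m - h \in `[m - h, m + h] by rewrite in_itv/=; lra.
rewrite opprB.
have -> : m - h - m = - h by ring.
have -> : m + h - m = h by ring.
have -> : m + h + (h - m) = 2 * h by ring.
rewrite scaleNr opprK normrN gtr0_norm// sqrrN => B A.
have -> : g 0%N (m + h) - g 0%N (m - h) - (2 * h) *: g 1%N m =
    (g 0%N (m + h) - g 0%N m - h *: g 1%N m - (h ^+ 2 / 2) *: g 2%N m) -
    (g 0%N (m - h) - g 0%N m + h *: g 1%N m - (h ^+ 2 / 2) *: g 2%N m).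
  have -> : 2 * h = h + h by ring.
  rewrite scalerDl !opprD !opprK.
  rewrite [RHS](AC (4*4) ((1*5*(3*7))*(2*6)*(4*8)))/=.
  by rewrite !addNr !addr0.
apply: le_trans (ler_normB _ _) _; apply: le_trans (lerD A B) _.
have : 0 <= K1 * h ^+ 3 by rewrite mulr_ge0// exprn_ge0// ltW.
have -> : h ^+ 3 = h * h * h by rewrite !exprS expr0; ring.
lra.
Qed.

End MeanValue.

(** * Energy law and solution of the scheme *)

Section Scheme.
Context (R : realType) (d : nat) (Omega : set 'rV[R]_d).
Context (V : normedModType R) (ev : V -> 'rV[R]_d -> R).
Hypothesis Omega_open : open Omega.
Hypothesis V_functions : function_space Omega ev.
Context (G L : {linear V -> V}) (E1 : V -> R) (U : V -> V).
Hypothesis G_npos : nonpositive_op Omega ev G.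
Hypothesis L_sym : symmetric_op Omega ev L.
Hypothesis L_nneg : nonnegative_op Omega ev L.

Local Notation ip := (inner Omega ev).
Local Notation Dl := (innerDl Omega_open V_functions).
Local Notation Dr := (innerDr Omega_open V_functions).
Local Notation Zl := (innerZl Omega_open V_functions).
Local Notation Zr := (innerZr Omega_open V_functions).
Local Notation Bl := (innerBl Omega_open V_functions).
Local Notation Br := (innerBr Omega_open V_functions).

(** Once [E1] and [U] enter only through [sav_b], the algebra of the scheme can treat this vector as
    arbitrary. *)
Lemma sav_dr_b (phi0 phib phi1 : V) :
  sav_dr ip E1 U phi0 phib phi1 = 2^-1 * ip (sav_b E1 U phib) (phi1 - phi0).
Proof. by rewrite /sav_dr /sav_b !Zl invfM mulrA. Qed.

Lemma sav_mu_b (phi0 : V) (r0 : R) (phib phi1 : V) (r1 : R) :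
  sav_mu L E1 U phi0 r0 phib phi1 r1 =
  2^-1 *: L (phi1 + phi0) + ((r1 + r0) / 2) *: sav_b E1 U phib.
Proof. by rewrite /sav_mu /sav_b scalerA invfM mulrA. Qed.

Lemma sav_cn_energy (dt : R) (phi0 : V) (r0 : R) (phib phi1 mu : V) (r1 : R) :
  0 < dt -> sav_cn ip G L E1 U dt phi0 r0 phib phi1 mu r1 ->
  dt^-1 * (sav_energy ip L phi1 r1 - sav_energy ip L phi0 r0) = ip mu (G mu).
Proof.
(* Replacing [G mu] by the difference quotient lets the factor [dt^-1] cancel and leaves an identity
   without [G]. *)
move=> dt0 [<- mueq req]; rewrite Zr; congr (_ * _).
move: req; rewrite sav_dr_b mueq sav_mu_b.
move: (sav_b E1 U phib) => b req; rewrite Dl !Zl /sav_energy.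
(* The third equation of the scheme gives [ip b (phi1 - phi0) = 2 * (r1 - r0)]. *)
have -> : (r1 + r0) / 2 * ip b (phi1 - phi0) = (r1 + r0) * (r1 - r0).
  by rewrite req; field.
rewrite (linearD L) Dl !Br (innerC _ _ (L phi1)) (innerC _ _ (L phi0)).
have -> : ip phi1 (L phi0) = ip phi0 (L phi1) by rewrite -L_sym innerC.
by rewrite (innerC _ _ (L phi1) phi0) (innerC _ _ (L phi0) phi0); field.
Qed.

(* With w = b + c L x2 one has x2 = G w, hence
   (b, x2) = (w, G w) - c (L x2, x2). *)
Lemma inner_resolvent_le0 (c : R) (b x2 : V) : 0 <= c ->
  x2 - c *: G (L x2) = G b -> ip b x2 <= 0.
Proof.
move=> c0 x2eq; pose w := b + c *: L x2.
have x2w : x2 = G w by rewrite /w (linearD G) (linearZ_LR G)/= -x2eq subrK.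
have -> : ip b x2 = ip w (G w) - c * ip x2 (L x2).
  by rewrite -x2w /w Dl Zl (innerC _ _ (L x2)); ring.
have := G_npos w; have : 0 <= c * ip x2 (L x2) by rewrite mulr_ge0.
lra.
Qed.

Lemma sav_denom_gt0 (dt : R) (phib x2 : V) : 0 < dt ->
  x2 - (dt / 2) *: G (L x2) = sav_rhs2 G E1 U phib ->
  0 < sav_denom ip E1 U dt phib x2.
Proof.
move=> dt0 /inner_resolvent_le0 b0; rewrite /sav_denom.
have : dt / 4 * ip (sav_b E1 U phib) x2 <= 0.
  by rewrite pmulr_rle0 ?divr_gt0// b0// ltW// divr_gt0.
lra.
Qed.

(** The residual of the eliminated equation is [dt] times that of the first equation of the scheme,
    so either one vanishes with the other. Both directions matter: one shows that every solution has
    the announced form, the other that this form solves the scheme. *)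
Lemma sav_cn_eliminated (dt : R) (phi0 : V) (r0 : R) (phib phi1 : V) :
  let r1 := r0 + sav_dr ip E1 U phi0 phib phi1 in
  0 < dt ->
  dt^-1 *: (phi1 - phi0) = G (sav_mu L E1 U phi0 r0 phib phi1 r1) <->
  phi1 - (dt / 2) *: G (L phi1) = sav_rhs1 ip G L E1 U dt phi0 r0 phib +
    (dt / 4 * ip (sav_b E1 U phib) phi1) *: sav_rhs2 G E1 U phib.
Proof.
move=> r1 dt0; rewrite sav_mu_b /r1 sav_dr_b Br /sav_rhs1 /sav_rhs2.
move: (sav_b E1 U phib) => b.
rewrite (linearD L) (linearD G) !(linearZ_LR G)/= (linearD G).
set x := ip b phi1; set y := ip b phi0.
(* The known part of the averaged auxiliary variable is separated from the unknown scalar [x]. *)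
have -> : (r0 + 2^-1 * (x - y) + r0) / 2 = (r0 - 4^-1 * y) + x / 4 by field.
set p := phi1 - (dt / 2) *: _; set q := _ + (dt / 4 * x) *: _.
suff pq : p - q = dt *: (dt^-1 *: (phi1 - phi0) -
    (2^-1 *: (G (L phi1) + G (L phi0)) + (r0 - 4^-1 * y + x / 4) *: G b)).
  split=> /eqP; rewrite -subr_eq0 => /eqP eq0; apply/eqP; rewrite -subr_eq0.
    by rewrite pq eq0 scaler0.
  have : dt *: (dt^-1 *: (phi1 - phi0) -
    (2^-1 *: (G (L phi1) + G (L phi0)) + (r0 - 4^-1 * y + x / 4) *: G b)) = 0.
    by rewrite -pq.
  by move=> /eqP; rewrite scaler_eq0 gt_eqF.
rewrite scalerBr !scalerDr !scalerA divff ?gt_eqF// scale1r.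
have -> : dt * (r0 - 4^-1 * y + x / 4) = dt * (r0 - 4^-1 * y) + dt / 4 * x.
  by field.
rewrite [in RHS]scalerDl /p /q !opprD.
by rewrite scale1r [LHS](AC (2*4) ((1*3)*((2*4)*(5*6)))).
Qed.

Lemma sav_cn_solution (dt : R) (phi0 : V) (r0 : R) (phib x1 x2 : V) :
  0 < dt ->
  (forall x, x - (dt / 2) *: G (L x)
     = sav_rhs1 ip G L E1 U dt phi0 r0 phib <-> x = x1) ->
  (forall x, x - (dt / 2) *: G (L x) = sav_rhs2 G E1 U phib <-> x = x2) ->
  forall (phi1 mu : V) (r1 : R),
    sav_cn ip G L E1 U dt phi0 r0 phib phi1 mu r1 <->
    [/\ phi1 = x1 + sav_coef ip E1 U dt phib x1 x2 *: x2,
        r1 = r0 + sav_dr ip E1 U phi0 phib phi1 &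
        mu = sav_mu L E1 U phi0 r0 phib phi1 r1].
Proof.
move=> dt0 x1P x2P phi1 mu r1.
have x1E := (x1P x1).2 erefl; have x2E := (x2P x2).2 erefl.
have den0 : sav_denom ip E1 U dt phib x2 != 0.
  by rewrite gt_eqF// sav_denom_gt0.
(* The second and third equations define [mu] and [r1] explicitly, so only an equation for [phi1]
   remains. *)
suff key : dt^-1 *: (phi1 - phi0) = G (sav_mu L E1 U phi0 r0 phib phi1
      (r0 + sav_dr ip E1 U phi0 phib phi1)) <->
    phi1 = x1 + sav_coef ip E1 U dt phib x1 x2 *: x2.
  split=> [[e1 e2 e3]|[e1 e2 e3]].
    have r1E : r1 = r0 + sav_dr ip E1 U phi0 phib phi1 by rewrite -e3; ring.
    by split=> //; apply/key; rewrite -r1E -e2.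
  split=> //; last by rewrite e2; ring.
  by rewrite e3 e2; exact/key.
rewrite (sav_cn_eliminated _ _ _ _ dt0).
have resE (s : R) : (x1 + s *: x2) - (dt / 2) *: G (L (x1 + s *: x2)) =
    sav_rhs1 ip G L E1 U dt phi0 r0 phib + s *: sav_rhs2 G E1 U phib.
  rewrite -x1E -x2E (linearD L) (linearD G) (linearZ_LR L) (linearZ_LR G)/=.
  rewrite scalerDr opprD addrACA; congr (_ + _).
  by rewrite scalerBr !scalerA [s * _]mulrC.
split=> [eq1|->].
  set s := dt / 4 * _ in eq1.
  have phi1E : phi1 = x1 + s *: x2.
    (* By linearity [phi1 - s *: x2] solves the equation that characterises [x1]. *)
    rewrite -[LHS](subrK (s *: x2)); congr (_ + _); apply/x1P.
    rewrite (linearB L) (linearB G) (linearZ_LR L) (linearZ_LR G)/=.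
    rewrite scalerBr opprD [- - _]opprK addrACA eq1 -x2E.
    rewrite scalerBr !scalerA [s * _]mulrC -addrA.
    rewrite [X in _ + X](_ : _ = 0) ?addr0//.
    by rewrite addrACA subrr addNr addr0.
  (* Pairing with [sav_b] closes a scalar linear equation for [s], solved by dividing by the nonzero
     denominator. *)
  have sE : s = dt / 4 * (ip (sav_b E1 U phib) x1 + s * ip (sav_b E1 U phib) x2).
    by rewrite -Zr -Dr -phi1E.
  rewrite {1}phi1E; congr (_ + _ *: _); rewrite /sav_coef.
  apply: (mulIf den0); rewrite divfK// /sav_denom mulrBr mulr1 {1}sE; ring.
(* Conversely, superposition leaves only the check that [sav_coef] satisfies the same scalar
   equation. *)
rewrite resE; congr (_ + _ *: _); rewrite Dr Zr.
have : sav_coef ip E1 U dt phib x1 x2 * sav_denom ip E1 U dt phib x2 =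
  dt / 4 * ip (sav_b E1 U phib) x1 by rewrite divfK.
by rewrite {1}/sav_denom; lra.
Qed.

End Scheme.

(** * Local Lipschitz estimates *)

Section Nonlinearity.
Context (R : realType) (d : nat) (Omega : set 'rV[R]_d).
Context (V : normedModType R) (ev : V -> 'rV[R]_d -> R) (N : V -> R).
Context (E1 : V -> R) (U : V -> V) (C0 : R).
Hypothesis Omega_open : open Omega.
Hypothesis V_functions : function_space Omega ev.
Hypothesis N_norm : stronger_norm N.
Hypothesis C0_gt0 : 0 < C0.
Hypothesis E1_ge : forall phi, C0 <= E1 phi.
Hypothesis E1_U : variational_derivative Omega ev E1 U.
Hypothesis U_lip : locally_lipschitz N U.

Local Notation ip := (inner Omega ev).

Lemma stronger_norm0 : N 0 = 0.
Proof. by have [_ NZ _] := N_norm; rewrite -(scale0r 0) NZ normr0 mul0r. Qed.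

Lemma stronger_normN u : N (- u) = N u.
Proof. by have [_ NZ _] := N_norm; rewrite -scaleN1r NZ normrN1 mul1r. Qed.

(** The triangle inequality for [u] and [- u] gives [0 <= 2 * N u]. *)
Lemma stronger_norm_ge0 u : 0 <= N u.
Proof.
have [ND _ _] := N_norm; have := ND u (- u).
by rewrite subrr stronger_norm0 stronger_normN; lra.
Qed.

(** Balls of [N] are convex, so local bounds around [phi] hold along the whole segment from [v] to
    [u]. *)
Lemma stronger_norm_segment (phi u v : V) (e t : R) : t \in `[0, 1] ->
  N (u - phi) < e -> N (v - phi) < e -> N (v + t *: (u - v) - phi) < e.
Proof.
rewrite in_itv/= => /andP[t0 t1] ue ve; have [ND NZ _] := N_norm.
have -> : v + t *: (u - v) - phi = t *: (u - phi) + (1 - t) *: (v - phi).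
  rewrite scalerBl scale1r !scalerBr opprD opprK.
  by rewrite [RHS](AC (2*(2*2)) ((3*(1*5))*4*(2*6)))/= addNr addr0.
apply: le_lt_trans (ND _ _) _; rewrite !NZ !ger0_norm ?subr_ge0//.
(* Strictness is taken from the term with weight [t], which must then be positive. *)
have [->|tn0] := eqVneq t 0; first by lra.
have : t * N (u - phi) < t * e by rewrite ltr_pM2l// lt_neqAle eq_sym tn0.
have : (1 - t) * N (v - phi) <= (1 - t) * e by rewrite ler_wpM2l ?subr_ge0// ltW.
lra.
Qed.

(** Comparison with the value at the centre turns the Lipschitz estimate into a local bound; the
    absolute value of the constant ensures its sign. *)
Lemma locally_lipschitz_bounded (f : V -> V) phi : locally_lipschitz N f ->
  exists e K M : R, [/\ 0 < e, 0 <= K, 0 <= M,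
    forall u, N (u - phi) < e -> `|f u| <= M &
    forall u v, N (u - phi) < e -> N (v - phi) < e ->
      `|f u - f v| <= K * N (u - v)].
Proof.
move=> /(_ phi)[e e0 [K KP]]; exists e, `|K|, (`|f phi| + `|K| * e); split => //.
- by rewrite addr_ge0// mulr_ge0// ltW.
- move=> u ue; have phie : N (phi - phi) < e by rewrite subrr stronger_norm0.
  rewrite -[f u](subrK (f phi)) addrC; apply: le_trans (ler_normD _ _) _.
  rewrite lerD2l; apply: le_trans (KP _ _ ue phie) _.
  apply: (@le_trans _ _ (`|K| * N (u - phi))).
    by rewrite ler_wpM2r ?stronger_norm_ge0// ler_norm.
  by rewrite ler_wpM2l// ltW.
- move=> u v ue ve; apply: le_trans (KP _ _ ue ve) _.
  by rewrite ler_wpM2r ?stronger_norm_ge0// ler_norm.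
Qed.

(** The difference quotient of [E1] at [u + t *: w] in direction [w] is that of the one-variable
    restriction to the line. *)
Lemma is_derive_along (u w : V) (t : R) :
  is_derive t 1 (fun s : R => E1 (u + s *: w)) (ip (U (u + t *: w)) w).
Proof.
have [] := E1_U (u + t *: w) w; rewrite /derivable /derive.
have -> : (fun h : R => h^-1 *: ((E1 \o shift (u + t *: w)) (h *: w) -
      E1 (u + t *: w)))
  = (fun h : R => h^-1 *: (((fun s : R => E1 (u + s *: w)) \o shift t) (h *: 1) -
      E1 (u + t *: w))).
  apply/funext => h /=; do 3 congr (_ _).
  by rewrite [h *: 1]mulr1 scalerDl addrCA.
by move=> ? ?; apply: DeriveDef.
Qed.

(** On the segment from [v] to [u] the derivative of [E1] is [ip (U _) (u - v)], bounded through the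
    local bound on [U] and the domination of the norm of [V] by [N]. *)
Lemma energy_locally_lipschitz phi :
  exists2 e : R, 0 < e & exists2 K : R, 0 <= K & forall u v,
    N (u - phi) < e -> N (v - phi) < e -> `|E1 u - E1 v| <= K * N (u - v).
Proof.
have [_ _ [C CP]] := N_norm.
have [e [_ [M [e0 _ M0 UM _]]]] := locally_lipschitz_bounded phi U_lip.
have [K K0 ipK] := inner_bounded Omega_open V_functions.
exists e => //; exists (K * M * `|C|).
  by rewrite mulr_ge0// mulr_ge0// ltW.
move=> u v ue ve.
have dE t := is_derive_along v (u - v) t.
have := @mean_value_lipschitz R _ (fun s : R => E1 (v + s *: (u - v)))
  (fun s : R => ip (U (v + s *: (u - v))) (u - v)) 0 1 (K * (M * `|u - v|)) 1 0.
rewrite scale1r scale0r addr0 (addrC v) subrK subr0 normr1 mulr1 => H.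
apply: le_trans (H (fun t _ => dE t) _ _ _ _) _.
- move=> t t01; apply: le_trans (ipK _ _) _.
  apply: ler_wpM2l; first exact: ltW.
  apply: ler_wpM2r => //; apply: UM.
  by apply: stronger_norm_segment => //; exact: subset_itv_oo_cc.
- by apply: derivable_within_continuous => t _; have [] := dE t.
- by rewrite in_itv/= ler01 lexx.
- by rewrite in_itv/= ler01 lexx.
rewrite -!mulrA; apply: ler_wpM2l; first exact: ltW.
apply: ler_wpM2l => //; apply: le_trans (CP _) _.
by apply: ler_wpM2r; [exact: stronger_norm_ge0|exact: ler_norm].
Qed.

(** With [a], [b] the square roots, [1/a - 1/b = - (a^2 - b^2) / (a b (a + b))], and each of the
    three factors below is at least [Num.sqrt C0]. *)
Lemma sqrt_inv_lipschitz (x y : R) : C0 <= x -> C0 <= y ->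
  `|(Num.sqrt x)^-1 - (Num.sqrt y)^-1| <= (Num.sqrt C0)^-1 ^+ 3 * `|x - y|.
Proof.
move=> Cx Cy; set c := Num.sqrt C0.
have c0 : 0 < c by rewrite sqrtr_gt0.
have cx : c <= Num.sqrt x by rewrite ler_sqrt// (le_trans (ltW C0_gt0)).
have cy : c <= Num.sqrt y by rewrite ler_sqrt// (le_trans (ltW C0_gt0)).
have sqx : Num.sqrt x ^+ 2 = x by rewrite sqr_sqrtr// (le_trans (ltW C0_gt0)).
have sqy : Num.sqrt y ^+ 2 = y by rewrite sqr_sqrtr// (le_trans (ltW C0_gt0)).
rewrite -{2}sqx -{2}sqy.
move: (Num.sqrt x) (Num.sqrt y) cx cy => a b ca cb.
have a0 : 0 < a by exact: lt_le_trans ca.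
have b0 : 0 < b by exact: lt_le_trans cb.
have -> : a^-1 - b^-1 = - (a ^+ 2 - b ^+ 2) * (a^-1 * b^-1 * (a + b)^-1).
  by field; rewrite !gt_eqF// addr_gt0.
rewrite normrM normrN mulrC; apply: ler_wpM2r => //.
rewrite gtr0_norm ?mulr_gt0 ?invr_gt0 ?addr_gt0//.
rewrite !exprS expr0 mulr1 mulrA.
have ai : a^-1 <= c^-1 by rewrite lef_pV2.
have bi : b^-1 <= c^-1 by rewrite lef_pV2.
have abi : (a + b)^-1 <= c^-1 by rewrite lef_pV2 ?posrE ?addr_gt0//; lra.
have a0' : 0 <= a^-1 by rewrite invr_ge0 ltW.
have b0' : 0 <= b^-1 by rewrite invr_ge0 ltW.
apply: ler_pM => //; first exact: mulr_ge0.
  by rewrite invr_ge0 ltW// addr_gt0.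
exact: ler_pM.
Qed.

Lemma sav_b_locally_lipschitz : locally_lipschitz N (sav_b E1 U).
Proof.
move=> phi.
have [e1 e10 [KE KE0 EP]] := energy_locally_lipschitz phi.
have [e2 [KU [M [e20 KU0 M0 UM UP]]]] := locally_lipschitz_bounded phi U_lip.
exists (Num.min e1 e2); first by rewrite lt_min e10.
set c := (Num.sqrt C0)^-1.
have c0 : 0 < c by rewrite invr_gt0 sqrtr_gt0.
(* The first term varies [U] under the bounded factor [1 / sqrt E1]; the second varies that factor
   against the bound [M] on [U]. *)
exists (c * KU + c ^+ 3 * KE * M) => u v.
rewrite !lt_min => /andP[ue1 ue2] /andP[ve1 ve2]; rewrite /sav_b.
have -> : (Num.sqrt (E1 u))^-1 *: U u - (Num.sqrt (E1 v))^-1 *: U v =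
    (Num.sqrt (E1 u))^-1 *: (U u - U v) +
    ((Num.sqrt (E1 u))^-1 - (Num.sqrt (E1 v))^-1) *: U v.
  by rewrite scalerBr scalerBl addrA subrK.
apply: le_trans (ler_normD _ _) _; rewrite !normrZ mulrDl; apply: lerD.
  rewrite -mulrA; apply: ler_pM => //; last exact: UP.
  rewrite ger0_norm ?invr_ge0// lef_pV2 ?posrE ?sqrtr_gt0//.
    by rewrite ler_sqrt// (le_trans (ltW C0_gt0)).
  exact: lt_le_trans (E1_ge _).
rewrite mulrAC; apply: ler_pM => //; last exact: UM.
apply: le_trans (sqrt_inv_lipschitz (E1_ge _) (E1_ge _)) _.
rewrite -/c -[leRHS]mulrA; apply: ler_wpM2l; first by rewrite exprn_ge0// ltW.
exact: EP.
Qed.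

(** Compactness of the time segment makes the local constants uniform. A single [K] serves as bound,
    Lipschitz constant and inverse radius, because all three requirements hold for large values. *)
Lemma locally_lipschitz_trajectory (T : R) (phi : R -> V) (f : V -> V) :
  locally_lipschitz N f ->
  (forall t, t \in `[0, T] ->
    N (phi s - phi t) @[s --> within `[0, T] (nbhs t)] --> (0 : R)) ->
  exists2 K : R, 0 < K & forall t, t \in `[0, T] -> `|f (phi t)| <= K /\
    forall u, N (u - phi t) < K^-1 -> `|f u - f (phi t)| <= K * N (u - phi t).
Proof.
move=> fl phic.
have [ND _ _] := N_norm.
suff /filter_ex[K [K0 KP]] : \forall K \near +oo, 0 < K /\
    `[0, T]%classic `<=` (fun t => `|f (phi t)| <= K /\
    forall u, N (u - phi t) < K^-1 -> `|f u - f (phi t)| <= K * N (u - phi t)).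
  by exists K => // t tT; exact: KP.
near=> K; split; near: K; first exact: nbhs_pinfty_gt.
have /compact_near_coveringP/near_covering_withinP := @segment_compact R 0 T.
apply=> t tT.
have [e [K [M [e0 K0 M0 fM fK]]]] := locally_lipschitz_bounded (phi t) fl.
have e20 : 0 < e / 2 by rewrite divr_gt0.
have := cvgr_norm_lt _ (phic t tT) ; rewrite normr0 => /(_ _ _ e20).
rewrite near_withinE => near_t.
(* Half of the radius [e] is spent on moving from [phi t] to [phi s], the other half on moving from
   [phi s] to [u], since [A^-1 <= e / 2]. *)
exists ([set s | s \in `[0, T] -> `|N (phi s - phi t)| < e / 2],
        [set A | [/\ 0 < A, M <= A, K <= A & (e / 2)^-1 <= A]]).
  split => //; near=> A; split; near: A.
  - exact: nbhs_pinfty_gt.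
  - by apply: nbhs_pinfty_ge; exact: num_real.
  - by apply: nbhs_pinfty_ge; exact: num_real.
  - by apply: nbhs_pinfty_ge; exact: num_real.
move=> [s A] /= [sP [A0 MA KA eA]] sT.
have {sP} := sP sT; rewrite ger0_norm ?stronger_norm_ge0// => se.
have se' : N (phi s - phi t) < e by lra.
split; first by apply: le_trans MA; exact: fM.
move=> u uA.
have ue : N (u - phi s) < e / 2.
  apply: lt_le_trans uA _; rewrite -[leRHS]invrK lef_pV2// posrE invr_gt0//.
have ut : N (u - phi t) < e.
  have -> : u - phi t = (u - phi s) + (phi s - phi t) by rewrite addrA subrK.
  by apply: le_lt_trans (ND _ _) _; lra.
by apply: le_trans (fK _ _ ut se') _; rewrite ler_wpM2r ?stronger_norm_ge0.
Unshelve. all: by end_near. Qed.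

End Nonlinearity.

(** * Consistency *)

(** Recentres a time step at its midpoint [m] with half-length [h]. The grid times appear as
    equations so that they can be rewritten into the form used by the midpoint formulas. *)
Lemma O_dt2_step (R : realType) (T C : R) (e : R -> nat -> R) :
  (\forall dt \near 0^'+, forall (n : nat) (m h : R),
    n.+1%:R * dt <= T -> dt = 2 * h -> m = (n%:R + 2^-1) * dt ->
    n%:R * dt = m - h -> n.+1%:R * dt = m + h ->
    0 < h -> 0 <= m - h -> m + h <= T -> `|e dt n| <= C * dt ^+ 2) ->
  O_dt2 T e.
Proof.
move=> H; exists C; near=> dt => n nT.
have dt0 : 0 < dt by near: dt; exact: nbhs_right_gt.
have mh : n%:R * dt = (n%:R + 2^-1) * dt - dt / 2 by field.
have mh' : n.+1%:R * dt = (n%:R + 2^-1) * dt + dt / 2 by rewrite -natr1; field.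
apply: (near H dt _ n ((n%:R + 2^-1) * dt) (dt / 2)) => //.
- by field.
- by rewrite divr_gt0.
- by rewrite -mh mulr_ge0// ltW.
- by rewrite -mh'.
Unshelve. all: by end_near. Qed.

Section Consistency.
Context (R : realType) (d : nat) (Omega : set 'rV[R]_d).
Context (V : normedModType R) (ev : V -> 'rV[R]_d -> R) (N : V -> R).
Context (G L : {linear V -> V}) (E1 : V -> R) (U : V -> V) (C0 : R).
Hypothesis Omega_open : open Omega.
Hypothesis V_functions : function_space Omega ev.
Hypothesis N_norm : stronger_norm N.
Hypothesis C0_gt0 : 0 < C0.
Hypothesis E1_ge : forall phi, C0 <= E1 phi.
Hypothesis E1_U : variational_derivative Omega ev E1 U.
Hypothesis U_lip : locally_lipschitz N U.

Local Notation ip := (inner Omega ev).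
Local Notation b := (sav_b E1 U).

Lemma sav_b_consistency (T : R) (phi : R -> V) (phib : R -> nat -> V) :
  (forall t, t \in `[0, T] ->
    N (phi s - phi t) @[s --> within `[0, T] (nbhs t)] --> (0 : R)) ->
  O_dt2 T (fun dt n => N (phib dt n - phi ((n%:R + 2^-1) * dt))) ->
  exists2 K : R, 0 < K & (forall t, t \in `[0, T] -> `|b (phi t)| <= K) /\
    \forall dt \near 0^'+, forall n : nat, n.+1%:R * dt <= T ->
      `|b (phib dt n) - b (phi ((n%:R + 2^-1) * dt))| <= K * dt ^+ 2.
Proof.
move=> phic [Cp phibP].
have [K K0 KP] := locally_lipschitz_trajectory N_norm
  (sav_b_locally_lipschitz Omega_open V_functions N_norm C0_gt0 E1_ge E1_U U_lip)
  phic.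
(* One positive constant dominates both the bound [K] and the Lipschitz error [K * Cp]. *)
exists (K * (1 + `|Cp|)); first by rewrite mulr_gt0// ltr_wpDr.
split=> [t tT|].
  by apply: le_trans (KP t tT).1 _; rewrite mulrDr mulr1 lerDl mulr_ge0// ltW.
near=> dt => n nT.
have dt0 : 0 < dt by near: dt; exact: nbhs_right_gt.
have dt1 : dt < 1 by near: dt; exact: nbhs_right_lt.
(* Together with [dt < 1] this puts [phib dt n] within the radius [K^-1] where the Lipschitz
   estimate applies. *)
have dtK : dt < K^-1 / (1 + `|Cp|).
  near: dt; apply: nbhs_right_lt.
  by rewrite divr_gt0 ?invr_gt0// ltr_wpDr.
set m := (n%:R + 2^-1) * dt.
have mT : m \in `[0, T].
  have nT' : n%:R * dt + dt <= T by move: nT; rewrite -natr1 mulrDl mul1r.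
  have : 0 <= n%:R * dt by rewrite mulr_ge0// ltW.
  by rewrite in_itv/= /m mulrDl => n0; apply/andP; split; lra.
have Np : N (phib dt n - phi m) <= (1 + `|Cp|) * dt ^+ 2.
  apply: (@le_trans _ _ (Cp * dt ^+ 2)).
    apply: le_trans (ler_norm _) _.
    by move: n nT @m {mT}; near: dt; exact: phibP.
  by rewrite ler_wpM2r ?sqr_ge0//; have := ler_norm Cp; lra.
rewrite -mulrA; apply: le_trans ((KP m mT).2 _ _) _; last first.
  by rewrite ler_wpM2l// ltW.
apply: le_lt_trans Np _; move: dtK; rewrite ltr_pdivlMr ?ltr_wpDr// mulrC.
apply: le_lt_trans; rewrite expr2 mulrA ger_pMr ?mulr_gt0 ?ltr_wpDr//.
exact: ltW.
Unshelve. all: by end_near. Qed.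

Lemma sav_cn_consistency (T : R) (phi mu : R -> V) (r : R -> R)
    (phib : R -> nat -> V) : 0 < T ->
  smooth_solution L N T phi r -> sav_flow ip G L E1 U T phi mu r ->
  O_dt2 T (fun dt n => N (phib dt n - phi ((n%:R + 2^-1) * dt))) ->
  [/\ O_dt2 T (fun dt n =>
        `|residual_phi G dt (phi (n%:R * dt)) (phi (n.+1%:R * dt))
            (mu ((n%:R + 2^-1) * dt))|),
      O_dt2 T (fun dt n =>
        `|residual_mu L E1 U (phi (n%:R * dt)) (r (n%:R * dt))
            (phib dt n) (phi (n.+1%:R * dt)) (mu ((n%:R + 2^-1) * dt))
            (r (n.+1%:R * dt))|) &
      O_dt2 T (fun dt n =>
        residual_r ip E1 U dt (phi (n%:R * dt)) (r (n%:R * dt))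
          (phib dt n) (phi (n.+1%:R * dt)) (r (n.+1%:R * dt)))].
Proof.
move=> T0 [phiC LphiC rC phic] flow phibP.
have [Kb Kb0 [bK bbK]] := sav_b_consistency phic phibP.
have [K K0 ipK] := inner_bounded Omega_open V_functions.
have flowphi t : t \in `]0, T[ -> is_derive t 1 phi (G (mu t)).
  by move=> /flow[].
(* The flow equation for [phi] replaces its time derivative by [G (mu t)], so that the same vector
   occurs in the expansions of [phi] and [r]. *)
have flowr t : t \in `]0, T[ ->
    is_derive t 1 r (2^-1 * ip (b (phi t)) (G (mu t))).
  move=> /flow[[_ <-] _]; rewrite /sav_b innerZl//.
  by rewrite invfM mulrA.
have [Kp Kp0 phiK] := midpoint_difference phiC flowphi.
have [Kr Kr0 rK] := midpoint_difference rC flowr.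
(* [L] may be unbounded, so the average is expanded for the curve [L (phi t)] itself. *)
have [KL KL0 LK] := midpoint_average LphiC.
have [Ka Ka0 raK] := midpoint_average (Ck_curveW (isT : (2 <= 3)%N) rC).
have [g [g0r gc _]] := rC.
have [Ks Ks0 rsK] := within_continuous_bounded (gc 0%N isT).
rewrite {g gc}g0r in rsK.
split.
- apply: (@O_dt2_step _ _ Kp); near=> dt => n m h nT dth mE -> -> h0 mh0 mhT.
  rewrite normr_id -mE /residual_phi.
  have dt0 : 0 < dt by lra.
  have [pK _] := phiK m h h0 mh0 mhT.
  have -> : dt^-1 *: (phi (m + h) - phi (m - h)) - G (mu m) =
      dt^-1 *: (phi (m + h) - phi (m - h) - (2 * h) *: G (mu m)).
    by rewrite [RHS]scalerBr -dth scalerA mulVf ?gt_eqF// scale1r.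
  rewrite normrZ gtr0_norm ?invr_gt0// ler_pdivrMl//.
  apply: le_trans pK _; rewrite [leRHS]mulrCA; apply: ler_wpM2l => //.
  by rewrite -exprS; apply: lerXn2r; rewrite ?nnegrE; lra.
- apply: (@O_dt2_step _ _ (KL + Ka * Kb + Ks * Kb)).
  near=> dt => n m h nT dth mE -> -> h0 mh0 mhT.
  rewrite normr_id -mE /residual_mu sav_mu_b.
  have mT : m \in `]0, T[ by rewrite in_itv/=; lra.
  have [_ -> _] := flow m mT.
  have -> : (r m / Num.sqrt (E1 (phi m))) *: U (phi m) = r m *: b (phi m).
    by rewrite /sav_b scalerA.
  have := LK m h h0 mh0 mhT; rewrite -linearD => LKm.
  have := raK m h h0 mh0 mhT; rewrite /GRing.scale/= => raKm.
  have bm := bK m (subset_itv_oo_cc mT).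
  have bbm : `|b (phib dt n) - b (phi m)| <= Kb * dt ^+ 2.
    by rewrite mE; move: n nT {mE}; near: dt; exact: bbK.
  have rs : `|(r (m + h) + r (m - h)) / 2| <= Ks.
    have mhT' : m + h \in `[0, T] by rewrite in_itv/=; lra.
    have mhT'' : m - h \in `[0, T] by rewrite in_itv/=; lra.
    rewrite normrM (gtr0_norm (_ : 0 < 2^-1)) ?invr_gt0//.
    have := ler_normD (r (m + h)) (r (m - h)).
    by have := rsK _ mhT'; have := rsK _ mhT''; lra.
  (* Three second-order errors are separated: averaging [L phi], averaging [r], and replacing [phi]
     by [phib] inside [b]. *)
  have -> : L (phi m) + r m *: b (phi m) -
      (2^-1 *: L (phi (m + h) + phi (m - h)) +
       ((r (m + h) + r (m - h)) / 2) *: b (phib dt n)) =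
      - (2^-1 *: L (phi (m + h) + phi (m - h)) - L (phi m)) -
      (2^-1 * (r (m + h) + r (m - h)) - r m) *: b (phi m) -
      ((r (m + h) + r (m - h)) / 2) *: (b (phib dt n) - b (phi m)).
    set rA := (_ + _) / 2; rewrite [2^-1 * _]mulrC -/rA.
    set B := b (phi m); set Bb := b (phib dt n).
    set A := 2^-1 *: _.
    rewrite opprB scalerBl scalerBr !opprB.
    rewrite opprD [LHS]addrACA -[RHS]addrA; congr (_ + _).
    by rewrite addrA subrK.
  have h2 : h ^+ 2 <= dt ^+ 2 by apply: lerXn2r; rewrite ?nnegrE; lra.
  apply: le_trans (ler_normB _ _) _; rewrite [leRHS]mulrDl; apply: lerD; last first.
    rewrite normrZ -mulrA; apply: ler_pM => //.
  apply: le_trans (ler_normB _ _) _; rewrite [leRHS]mulrDl; apply: lerD.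
    by rewrite normrN; apply: le_trans LKm _; apply: ler_wpM2l.
  rewrite normrZ mulrAC; apply: ler_pM => //.
  by apply: le_trans raKm _; apply: ler_wpM2l.
- apply: (@O_dt2_step _ _ (Kr + K * (Kb * Kp) + K * (Kb * Kp))).
  near=> dt => n m h nT dth mE -> -> h0 mh0 mhT.
  rewrite /residual_r sav_dr_b//.
  have mT : m \in `]0, T[ by rewrite in_itv/=; lra.
  have dt0 : 0 < dt by lra.
  have [rKm _] := rK m h h0 mh0 mhT.
  have [pKm pKm'] := phiK m h h0 mh0 mhT.
  have bm := bK m (subset_itv_oo_cc mT).
  have bbm : `|b (phib dt n) - b (phi m)| <= Kb * dt ^+ 2.
    by rewrite mE; move: n nT {mE}; near: dt; exact: bbK.
  move: (phi (m + h) - phi (m - h)) pKm pKm' => dp pKm pKm'.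
  (* The midpoint values cancel by the flow equation for [r]. The first two terms are third-order
     midpoint errors; the last pairs a second-order error in [b] with a first-order increment.
     Division by [dt] leaves second order. *)
  have -> : r (m + h) - r (m - h) - 2^-1 * ip (b (phib dt n)) dp =
      (r (m + h) - r (m - h) - (2 * h) * (2^-1 * ip (b (phi m)) (G (mu m)))) -
      2^-1 * ip (b (phi m)) (dp - (2 * h) *: G (mu m)) -
      2^-1 * ip (b (phib dt n) - b (phi m)) dp.
    by rewrite innerBr// innerBl// innerZr//; ring.
  have h2 : h ^+ 3 <= dt ^+ 3.
    by apply: lerXn2r; rewrite ?nnegrE; lra.
  have half (x : R) : `|2^-1 * x| <= `|x|.
    rewrite normrM (gtr0_norm (_ : 0 < 2^-1)) ?invr_gt0//.
    by have := normr_ge0 x; lra.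
  rewrite normrM (gtr0_norm (_ : 0 < dt^-1)) ?invr_gt0// ler_pdivrMr//.
  rewrite -[leRHS]mulrA -exprSr.
  apply: le_trans (ler_normB _ _) _; rewrite [leRHS]mulrDl; apply: lerD; last first.
    apply: le_trans (half _) _; apply: le_trans (ipK _ _) _.
    rewrite -mulrA; apply: ler_wpM2l; first exact: ltW.
    apply: (@le_trans _ _ (Kb * dt ^+ 2 * (Kp * h))); first exact: ler_pM.
    rewrite mulrACA [dt ^+ 3]exprSr; apply: ler_wpM2l.
      by rewrite mulr_ge0// ltW.
    by apply: ler_wpM2l; [rewrite sqr_ge0|lra].
  apply: le_trans (ler_normB _ _) _; rewrite [leRHS]mulrDl; apply: lerD.
    by apply: le_trans rKm _; apply: ler_wpM2l.
  apply: le_trans (half _) _; apply: le_trans (ipK _ _) _.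
  rewrite -!mulrA; apply: ler_wpM2l; first exact: ltW.
  apply: ler_pM => //; apply: le_trans pKm _; exact: ler_wpM2l.
Unshelve. all: by end_near. Qed.

End Consistency.

(** * Consistency, energy stability and solvability combined *)

Theorem theorem2p1 (R : realType) (d : nat) (Omega : set 'rV[R]_d)
    (V : normedModType R) (ev : V -> 'rV[R]_d -> R) (N : V -> R)
    (G L : {linear V -> V}) (E1 : V -> R) (U : V -> V) (C0 : R)
    (Omega_domain : domain Omega)
    (V_functions : function_space Omega ev)
    (N_norm : stronger_norm N)
    (G_sym : symmetric_op Omega ev G)
    (G_npos : nonpositive_op Omega ev G)
    (L_sym : symmetric_op Omega ev L)
    (L_nneg : nonnegative_op Omega ev L)
    (C0_gt0 : 0 < C0)
    (E1_ge : forall phi, C0 <= E1 phi)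
    (E1_U : variational_derivative Omega ev E1 U)
    (U_lip : locally_lipschitz N U)
    (GL_solvable : uniquely_solvable G L) :
  let ip := inner Omega ev in
  [/\
      forall (T : R) (phi mu : R -> V) (r : R -> R) (phib : R -> nat -> V),
        0 < T ->
        smooth_solution L N T phi r ->
        sav_flow ip G L E1 U T phi mu r ->
        O_dt2 T (fun dt n => N (phib dt n - phi ((n%:R + 2^-1) * dt))) ->
        [/\ O_dt2 T (fun dt n =>
              `|residual_phi G dt (phi (n%:R * dt)) (phi (n.+1%:R * dt))
                  (mu ((n%:R + 2^-1) * dt))|),
            O_dt2 T (fun dt n =>
              `|residual_mu L E1 U (phi (n%:R * dt)) (r (n%:R * dt))
                  (phib dt n) (phi (n.+1%:R * dt)) (mu ((n%:R + 2^-1) * dt))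
                  (r (n.+1%:R * dt))|) &
            O_dt2 T (fun dt n =>
              residual_r ip E1 U dt (phi (n%:R * dt)) (r (n%:R * dt))
                (phib dt n) (phi (n.+1%:R * dt)) (r (n.+1%:R * dt)))],
      forall (dt : R) (phi0 : V) (r0 : R) (phib phi1 mu : V) (r1 : R),
        0 < dt ->
        sav_cn ip G L E1 U dt phi0 r0 phib phi1 mu r1 ->
        dt^-1 * (sav_energy ip L phi1 r1 - sav_energy ip L phi0 r0)
          = ip mu (G mu) /\ ip mu (G mu) <= 0 &
      forall (dt : R) (phi0 : V) (r0 : R) (phib : V),
        0 < dt ->
        exists x1 x2 : V,
          [/\ forall x, x - (dt / 2) *: G (L x)
                = sav_rhs1 ip G L E1 U dt phi0 r0 phib <-> x = x1,
              forall x, x - (dt / 2) *: G (L x)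
                = sav_rhs2 G E1 U phib <-> x = x2,
              sav_denom ip E1 U dt phib x2 != 0 &
              forall (phi1 mu : V) (r1 : R),
                sav_cn ip G L E1 U dt phi0 r0 phib phi1 mu r1 <->
                [/\ phi1 = x1 + sav_coef ip E1 U dt phib x1 x2 *: x2,
                    r1 = r0 + sav_dr ip E1 U phi0 phib phi1 &
                    mu = sav_mu L E1 U phi0 r0 phib phi1 r1]]].
Proof.
have [oOmega _ _] := Omega_domain.
move=> ip; split.
- move=> T phi mu r phib.
  exact: (sav_cn_consistency oOmega V_functions N_norm C0_gt0 E1_ge E1_U U_lip).
- move=> dt phi0 r0 phib phi1 mu r1 dt0 cn; split; last exact: G_npos.
  exact: sav_cn_energy cn.
move=> dt phi0 r0 phib dt0.
(* Unique solvability with [c = 2^-1] is recast as an equivalence that both produces and recognises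
   the solution. *)
have soln y : exists x1, forall x,
    x - (dt / 2) *: G (L x) = y <-> x = x1.
  have half0 : 0 < 2^-1 :> R by rewrite invr_gt0.
  have [x1 [+ x1U]] := GL_solvable _ _ half0 dt0 y; rewrite [2^-1 * dt]mulrC.
  move=> x1E; exists x1 => x; split=> [xE|-> //].
  by apply/esym/x1U; rewrite mulrC.
have [x1 x1P] := soln (sav_rhs1 ip G L E1 U dt phi0 r0 phib).
have [x2 x2P] := soln (sav_rhs2 G E1 U phib).
exists x1, x2; split=> //.
  rewrite gt_eqF//.
  exact: (sav_denom_gt0 oOmega V_functions G_npos L_nneg dt0 ((x2P x2).2 erefl)).
exact: (sav_cn_solution oOmega V_functions G_npos L_nneg dt0).
Qed.
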